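(* The Alexander polynomial is a quantum cocycle invariant in the following sense. There exist a free module $V$ of finite rank over $\mathbb k$, an integer $N$, a Yang--Baxter operator $(\tilde R_{(N)},\tilde R^{-1}_{(N)})$ obtained by Laurent deformation of order $N$ on $V$, and a linear endomorphism $\mu$ of $V$, such that for every knot $K$ represented as the closure of an $m$-braid $b_m$ with $m^+$ positive and $m^-$ negative crossings, $$\Delta(K)\cdot\mathbb 1=\hbar^{-m^++m^-+m-1}\,\mathrm{Tr}_{2,\dots,m}\Big(\Psi_{(\tilde R_{(N)},\tilde R^{-1}_{(N)})}(b_m)\,(\mathbb 1\otimes\mu^{\otimes(m-1)})\Big),$$ where $\Delta(K)$ is the Alexander polynomial with $t^{1/2}=\hbar$, $\mathbb 1$ is the identity, and $\mathrm{Tr}_{2,\dots,m}$ is the partial trace over the tensor factors $2,3,\dots,m$.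
   Context: $\mathbb k$ is a commutative unital ring; $\Delta(K)$ is regarded as an element of $\mathbb k[\hbar,\hbar^{-1}]$ through $\mathbb Z\to\mathbb k$, and maps on $V$ are extended to $\mathbb k[\hbar,\hbar^{-1}]\otimes V$. A pre-Yang--Baxter operator (pre-YBO) is a linear map $R:V\otimes V\to V\otimes V$, not necessarily invertible, with $(R\otimes\mathbb 1)(\mathbb 1\otimes R)(R\otimes\mathbb 1)=(\mathbb 1\otimes R)(R\otimes\mathbb 1)(\mathbb 1\otimes R)$. Laurent deformation of (finite) order $N$: maps $\phi_0,\dots,\phi_N,\hat\phi_0,\dots,\hat\phi_N\in\mathrm{Hom}(V^{\otimes 2},V^{\otimes2})$ such that, for each $n=0,\dots,N$, $\tilde R_{(n)}=\sum_{i=0}^n\hbar^i\phi_i$ is a pre-YBO on $\mathbb k[[\hbar]]/(\hbar^{n+1})\otimes V$ and $\tilde R^{-1}_{(n)}=\sum_{i=0}^n\hat\hbar^i\hat\phi_i$ is a pre-YBO on $\mathbb k[[\hat\hbar]]/(\hat\hbar^{n+1})\otimes V$, and such that, after setting $\hat\hbar=\hbar^{-1}$, the operators $\tilde R_{(N)}$ and $\tilde R_{(N)}^{-1}$ satisfy the Yang--Baxter equation exactly and are mutually inverse over $\mathbb k[\hbar,\hbar^{-1}]$. $\Psi_{(\tilde R_{(N)},\tilde R^{-1}_{(N)})}$ is the braid group representation sending $\sigma_i^{\pm1}$ to $\mathbb 1^{\otimes(i-1)}\otimes\tilde R_{(N)}^{\pm1}\otimes\mathbb 1^{\otimes(m-i-1)}$,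 $\sigma_i$ being a positive crossing. In the paper a ''knot'' means a knot or a link, oriented. Alexander polynomial convention: $\Delta(\text{unknot})=1$ and $\Delta(L_+)-\Delta(L_-)=(t^{-1/2}-t^{1/2})\Delta(L_0)$ for a skein triple; this differs from the other common convention only by the sign $(-1)^{c-1}$, $c$ the number of components (no difference for knots). *)

(* Defs.v *)
From HB Require Import structures.
From mathcomp Require Import all_boot all_order all_algebra finmap.
From mathcomp.real_closed Require Import mxtens.

Set Implicit Arguments.
Unset Strict Implicit.
Unset Printing Implicit Defensive.

Import GRing.Theory.
Local Open Scope ring_scope.

Section Laurent.
Variable k : comNzRingType.

(** Finitely supported coefficient functions; [f i] is the coefficient of the
    [i]-th power of the variable. *)
Definition laurent := {fsfun int -> k with 0}.

HB.instance Definition _ := Choice.on laurent.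

Implicit Types (f g h : laurent) (i j n : int) (c : k).

Definition laurent0 : laurent := [fsfun with 0].
Definition laurent_mono n c : laurent := [fsfun _ in [fset n]%fset => c].
Definition laurent_opp f : laurent := [fsfun n in finsupp f => - f n].
Definition laurent_add f g : laurent :=
  [fsfun n in (finsupp f `|` finsupp g)%fset => f n + g n].
Definition laurent_mul f g : laurent :=
  [fsfun n in [fset (i + j)%R | i in finsupp f, j in finsupp g]%fset =>
    \sum_(i <- finsupp f) f i * g (n - i)].
Definition laurent_scale c f : laurent := [fsfun n in finsupp f => c * f n].

Lemma laurent0E n : laurent0 n = 0.
Proof. exact: fsfun0E. Qed.

Lemma laurent_monoE m c n : laurent_mono m c n = if n == m then c else 0.
Proof. by rewrite fsfunE inE. Qed.

Lemma laurent_oppE f n : laurent_opp f n = - f n.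
Proof. by rewrite fsfunE; case: finsuppP => //; rewrite oppr0. Qed.

Lemma laurent_addE f g n : laurent_add f g n = f n + g n.
Proof.
by rewrite fsfunE inE; case: (finsuppP f); case: (finsuppP g) => //; rewrite addr0.
Qed.

Lemma laurent_scaleE c f n : laurent_scale c f n = c * f n.
Proof. by rewrite fsfunE; case: finsuppP => //; rewrite mulr0. Qed.

Lemma laurent_mulE f g n :
  laurent_mul f g n = \sum_(i <- finsupp f) f i * g (n - i).
Proof.
rewrite fsfunE; case: ifPn => // nS; rewrite big_seq big1 // => i fi.
case: (finsuppP g (n - i)) => gi; first by rewrite mulr0.
case/negP: nS; apply/imfset2P; exists i => //; exists (n - i) => //.
by rewrite addrC subrK.
Qed.

Lemma laurent_addA : associative laurent_add.
Proof. by move=> f g h; apply/fsfunP => n; rewrite !laurent_addE addrA. Qed.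

Lemma laurent_addC : commutative laurent_add.
Proof. by move=> f g; apply/fsfunP => n; rewrite !laurent_addE addrC. Qed.

Lemma laurent_add0 : left_id laurent0 laurent_add.
Proof. by move=> f; apply/fsfunP => n; rewrite laurent_addE laurent0E add0r. Qed.

Lemma laurent_addN : left_inverse laurent0 laurent_opp laurent_add.
Proof.
by move=> f; apply/fsfunP => n; rewrite laurent_addE laurent_oppE laurent0E addNr.
Qed.

HB.instance Definition _ := GRing.isZmodule.Build laurent
  laurent_addA laurent_addC laurent_add0 laurent_addN.

(** A coefficient as a sum over any duplicate-free range. *)
Lemma laurent_pick (S : {fset int}) (F : int -> k) n :
  \sum_(j <- S) (if j == n then F j else 0) = if n \in S then F n else 0.
Proof.
case: ifPn => nS.
  rewrite (bigD1_seq n) ?fset_uniq //= eqxx big1 ?addr0 // => j /negPf-> //.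
rewrite big_seq big1 // => j jS; case: eqP => // jn.
by rewrite -jn jS in nS.
Qed.

Lemma laurent_mulE2 f g n : laurent_mul f g n =
  \sum_(i <- finsupp f) \sum_(j <- finsupp g) if i + j == n then f i * g j else 0.
Proof.
rewrite laurent_mulE; apply: eq_bigr => i _.
rewrite (eq_bigr (fun j => if j == n - i then f i * g j else 0)).
  rewrite laurent_pick; case: (finsuppP g (n - i)) => //; by rewrite mulr0.
by move=> j _; rewrite addrC -(can_eq (addrK (- i))) addrK.
Qed.

Lemma laurent_mulC : commutative laurent_mul.
Proof.
move=> f g; apply/fsfunP => n; rewrite !laurent_mulE2 exchange_big /=.
by apply: eq_bigr => i _; apply: eq_bigr => j _; rewrite addrC mulrC.
Qed.

Lemma laurent_mulCA f g h :
  laurent_mul f (laurent_mul g h) = laurent_mul g (laurent_mul f h).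
Proof.
apply/fsfunP => n; rewrite !laurent_mulE.
under eq_bigr do rewrite laurent_mulE mulr_sumr.
under [RHS]eq_bigr do rewrite laurent_mulE mulr_sumr.
rewrite exchange_big /=; apply: eq_bigr => i _; apply: eq_bigr => j _.
by rewrite mulrCA addrAC.
Qed.

Lemma laurent_mulA : associative laurent_mul.
Proof. by move=> f g h; rewrite (laurent_mulC g) laurent_mulCA laurent_mulC. Qed.

Lemma laurent_monoM m c f n : laurent_mul (laurent_mono m c) f n = c * f (n - m).
Proof.
rewrite laurent_mulE; case: (eqVneq c 0) => [->|c0].
  by rewrite mul0r big1 // => i _; rewrite laurent_monoE if_same mul0r.
rewrite (_ : finsupp _ = [fset m]%fset).
  by rewrite big_seq_fset1 laurent_monoE eqxx.
apply/fsetP => i; rewrite mem_finsupp laurent_monoE inE.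
by case: (i == m); rewrite ?c0 ?eqxx.
Qed.

Lemma laurent_mul1 : left_id (laurent_mono 0 1) laurent_mul.
Proof. by move=> f; apply/fsfunP => n; rewrite laurent_monoM mul1r subr0. Qed.

Lemma laurent_mulD : left_distributive laurent_mul laurent_add.
Proof.
move=> f g h; rewrite ![laurent_mul _ h]laurent_mulC; apply/fsfunP => n.
rewrite laurent_addE !laurent_mulE -big_split /=.
by apply: eq_bigr => i _; rewrite laurent_addE mulrDr.
Qed.

Lemma laurent_1neq0 : laurent_mono 0 1 != 0 :> laurent.
Proof.
apply/eqP => /fsfunP/(_ 0); rewrite laurent_monoE eqxx laurent0E.
by apply/eqP/oner_neq0.
Qed.

HB.instance Definition _ := GRing.Zmodule_isComNzRing.Build laurent
  laurent_mulA laurent_mulC laurent_mul1 laurent_mulD laurent_1neq0.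

Lemma laurent_scaleA c d f :
  laurent_scale c (laurent_scale d f) = laurent_scale (c * d) f.
Proof. by apply/fsfunP => n; rewrite !laurent_scaleE mulrA. Qed.

Lemma laurent_scale1 : left_id 1 laurent_scale.
Proof. by move=> f; apply/fsfunP => n; rewrite laurent_scaleE mul1r. Qed.

Lemma laurent_scaleDr : right_distributive laurent_scale +%R.
Proof.
by move=> c f g; apply/fsfunP => n;
  rewrite !(laurent_scaleE, laurent_addE) mulrDr.
Qed.

Lemma laurent_scaleDl f : {morph laurent_scale^~ f : c d / c + d}.
Proof.
by move=> c d; apply/fsfunP => n; rewrite !(laurent_scaleE, laurent_addE) mulrDl.
Qed.

HB.instance Definition _ := GRing.Zmodule_isLmodule.Build k laurent
  laurent_scaleA laurent_scale1 laurent_scaleDr laurent_scaleDl.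

Lemma laurent_scaleAl c f g : c *: (f * g) = c *: f * g :> laurent.
Proof.
rewrite -[LHS]/(laurent_scale c (laurent_mul f g)).
rewrite -[RHS]/(laurent_mul (laurent_scale c f) g).
rewrite ![laurent_mul _ g]laurent_mulC; apply/fsfunP => n.
rewrite laurent_scaleE !laurent_mulE mulr_sumr.
by apply: eq_bigr => i _; rewrite laurent_scaleE mulrCA.
Qed.

HB.instance Definition _ := GRing.Lmodule_isLalgebra.Build k laurent
  laurent_scaleAl.
HB.instance Definition _ := GRing.Lalgebra_isComAlgebra.Build k laurent.

End Laurent.

Notation "''h^' n" := (laurent_mono n%R 1)
  (at level 1, n at level 2, format "''h^' n") : ring_scope.

(** The base change along the unique ring map from the integers to [k]. *)
Definition laurent_of_int (k : comNzRingType) (f : laurent int) : laurent k :=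
  [fsfun n in finsupp f => (f n)%:~R].

(** [V] is the free module with basis indexed by ['I_d], [V^(x)m] the one of
    rank [d ^ m] and the tensor product of maps is the Kronecker product
    [*t]; matrices act on columns, so that [*m] is composition. *)
Section Operators.
Variables (A : comNzRingType) (d : nat).
Implicit Types (R : 'M[A]_(d * d)).

Definition pre_YBO R : Prop :=
  let R12 := R *t (1%:M : 'M_d) in
  let R23 := castmx (mulnA d d d, mulnA d d d) ((1%:M : 'M_d) *t R) in
  R12 *m R23 *m R12 = R23 *m R12 *m R23.

Lemma local_dim n (i : 'I_n) : (d ^ i * (d * d) * d ^ (n - i.+1) = d ^ n.+1)%N.
Proof. by rewrite mulnn -!expnD addn2 addSn subnKC ?ltn_ord. Qed.

(** On [n + 1] strands; [i] is 0-based, so that [R] acts on the tensor factors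
    [i + 1] and [i + 2]. *)
Definition local_op n R (i : 'I_n) : 'M[A]_(d ^ n.+1) :=
  castmx (local_dim i, local_dim i)
    ((1%:M : 'M_(d ^ i)) *t R *t (1%:M : 'M_(d ^ (n - i.+1)))).

(** The partial trace over all tensor factors but the first. *)
Definition ptrace n (M : 'M[A]_(d ^ n.+1)) : 'M[A]_d :=
  let M' := castmx (expnS d n, expnS d n) M in
  \matrix_(i, j) \sum_(l < d ^ n) M' (mxtens_index (i, l)) (mxtens_index (j, l)).

Definition id_tens n (mu : 'M[A]_d) : 'M[A]_(d ^ n.+1) :=
  castmx (esym (expnS d n), esym (expnS d n)) ((1%:M : 'M_d) *t (mu ^t n)).

End Operators.

(** The operator [\sum_(i <= n) h^i phi_i] over a [k]-algebra containing [h]. *)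
Definition deform (k : comNzRingType) (A : comAlgType k) (h : A) (e N : nat)
    (phi : 'I_N.+1 -> 'M[k]_e) (n : nat) : 'M[A]_e :=
  \sum_(i < N.+1 | (i <= n)%N) h ^+ i *: map_mx (in_alg A) (phi i).

Section LaurentDeformation.
Variables (k : comNzRingType) (d N : nat).
Variables phi phi' : 'I_N.+1 -> 'M[k]_(d * d).

Definition laurent_R : 'M[laurent k]_(d * d) := deform ('h^1 : laurent k) phi N.
Definition laurent_Rinv : 'M[laurent k]_(d * d) :=
  deform ('h^(-1) : laurent k) phi' N.

(** [{poly %/ 'X^(n.+1)}] is [k[[h]]/(h^(n+1))]. *)
Record laurent_deformation : Prop := LaurentDeformation {
  deform_YBO : forall n, (n <= N)%N ->
    pre_YBO (deform ('qX : {poly %/ ('X^(n.+1) : {poly k})}) phi n);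
  deform_inv_YBO : forall n, (n <= N)%N ->
    pre_YBO (deform ('qX : {poly %/ ('X^(n.+1) : {poly k})}) phi' n);
  laurent_YBO : pre_YBO laurent_R;
  laurent_inv_YBO : pre_YBO laurent_Rinv;
  laurent_RK : laurent_R *m laurent_Rinv = 1%:M;
  laurent_RinvK : laurent_Rinv *m laurent_R = 1%:M }.

End LaurentDeformation.

(** Braid diagrams on [n + 1] strands: [(i, true)] is the positive crossing
    sigma_(i+1), [(i, false)] its inverse. *)
Definition braid n := seq ('I_n * bool).

Definition crossings n (s : bool) (b : braid n) : nat :=
  count (fun c => c.2 == s) b.

Definition add_strand n (b : braid n) : braid n.+1 :=
  [seq (widen_ord (leqnSn n) c.1, c.2) | c <- b].

(** A link is presented by a braid whose closure it is (Alexander's theorem);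
    [braid_closure b] is the closure of [b]. *)
Definition link := {n : nat & braid n}.
Definition braid_closure n (b : braid n) : link := existT (fun n => braid n) n b.

(** Ambient isotopy of oriented links, as Markov equivalence of braids (Markov's
    theorem). The first three generators present the braid groups. *)
Inductive isotopic : link -> link -> Prop :=
| isotopic_refl K : isotopic K K
| isotopic_sym K L : isotopic K L -> isotopic L K
| isotopic_trans K L M : isotopic K L -> isotopic L M -> isotopic K M
| isotopic_inv n (u v : braid n) (i : 'I_n) (s : bool) :
    isotopic (braid_closure (u ++ [:: (i, s); (i, ~~ s)] ++ v)) (braid_closure (u ++ v))
| isotopic_far n (u v : braid n) (i j : 'I_n) : (i.+1 < j)%N ->
    isotopic (braid_closure (u ++ [:: (i, true); (j, true)] ++ v))
             (braid_closure (u ++ [:: (j, true); (i, true)] ++ v))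
| isotopic_braid n (u v : braid n) (i j : 'I_n) : j = i.+1 :> nat ->
    isotopic (braid_closure (u ++ [:: (i, true); (j, true); (i, true)] ++ v))
             (braid_closure (u ++ [:: (j, true); (i, true); (j, true)] ++ v))
| isotopic_conj n (u v : braid n) : isotopic (braid_closure (u ++ v)) (braid_closure (v ++ u))
| isotopic_stab n (b : braid n) (s : bool) :
    isotopic (braid_closure b) (braid_closure (rcons (add_strand b) (ord_max, s))).

(** The Alexander polynomial, with ['h^1] for [t^(1/2)], is characterised by
    its skein relation. The skein triples are those of closed braids: every
    link has such a presentation, and these triples already determine the
    invariant. *)
Record is_alexander (Delta : link -> laurent int) : Prop := IsAlexander {
  alexander_isotopic : forall K L, isotopic K L -> Delta K = Delta L;
  alexander_unknot : Delta (braid_closure ([::] : braid 0)) = 1;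
  alexander_skein : forall n (u v : braid n) (i : 'I_n),
    Delta (braid_closure (u ++ (i, true) :: v)) - Delta (braid_closure (u ++ (i, false) :: v))
    = ('h^(-1) - 'h^1) * Delta (braid_closure (u ++ v)) }.

(** The representation sending sigma_i^(+1) to [R] and sigma_i^(-1) to [R']. *)
Definition braid_rep (A : comNzRingType) (d : nat) (R R' : 'M[A]_(d * d)) (n : nat)
    (b : braid n) : 'M[A]_(d ^ n.+1) :=
  \big[mulmx/1%:M]_(c <- b) local_op (if c.2 then R else R') c.1.

(* Main.v *)
Require Import Defs.
From mathcomp Require Import all_boot all_order all_algebra finmap.
From mathcomp.real_closed Require Import mxtens.
From mathcomp Require Import ring zify.

(** Take the free module with basis e_0, e_1 and the free-fermionic R-matrix
<<
  R = 1 (x) E00 + h (E01 (x) E10 + E10 (x) E01) - h^2 E11 (x) 1 ,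
>>
the one attached to the quantum supergroup of gl(1|1), with
mu = E00 - E11. Its eigenvalues are 1 and - h^2, so R satisfies the quadratic
relation of a Hecke algebra, and h^(-1) R - h R^(-1) = h^(-1) - h. This is the
skein relation, and it also shows that R^(-1) is a polynomial of degree two in
h^(-1): the deformation has order two. The Yang-Baxter equation holds
identically in h, over any commutative ring, so its truncations hold too
([alexander_R_YBO], [deform_truncate]).

That the normalised partial trace F of a braid computes the Alexander
polynomial Delta is proved by comparing the two as functionals on Hecke
algebras, by induction on the number of strands. Both factor through the Hecke
algebra, F because R is a Yang-Baxter operator with the skein relation
([alexander_trace_skein] and the lemmas after it), Delta by hypothesis. In the
Hecke algebra every element is a combination of words in which the last
generator t occurs at most once ([hecke_reduction]), hence Delta = F follows
from two cases. On a word u without t the closure has a split unknot, where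
Delta vanishes because h^(-1) - h is not a zero divisor in Z[h, h^(-1)], and F
vanishes because mu has trace zero. On a word u t v the value is that of u v
on one strand fewer: for Delta this is conjugation and Markov stabilisation,
for F it is the fact that the partial trace of R (1 (x) mu) over the second
factor is the identity ([ptrace_markov]).

The comparison is between the matrix F and the scalar matrix of Delta. That F is
scalar and invariant under conjugation, which is delicate to see directly since
the full trace of F is zero, comes out as a consequence of the equality. *)

Import GRing.Theory.
Local Open Scope ring_scope.
Set Implicit Arguments.
Unset Strict Implicit.
Unset Printing Implicit Defensive.

(** * Laurent polynomials *)

Section LaurentRing.
Variable k : comNzRingType.

Lemma laurent_monoD (a b : int) : 'h^(a + b) = 'h^a * 'h^b :> laurent k.
Proof.
apply/fsfunP => n; rewrite [RHS]laurent_monoM mul1r !laurent_monoE.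
by rewrite subr_eq addrC.
Qed.

Lemma laurent_mono0 : 'h^0 = 1 :> laurent k.
Proof. by []. Qed.

Lemma laurent_coefMmono a (f : laurent k) n : ('h^a * f) n = f (n - a).
Proof. by rewrite [LHS]laurent_monoM mul1r. Qed.

Lemma laurent_coefB (f g : laurent k) n : (f - g) n = f n - g n.
Proof. by rewrite [LHS]laurent_addE laurent_oppE. Qed.

Lemma laurent_of_intE (f : laurent int) n : laurent_of_int k f n = (f n)%:~R.
Proof. by rewrite fsfunE; case: finsuppP. Qed.

Lemma laurent_of_int1 : laurent_of_int k 1 = 1.
Proof.
apply/fsfunP => n; rewrite laurent_of_intE !laurent_monoE.
by case: ifP.
Qed.

Lemma laurent_of_int0 : laurent_of_int k 0 = 0.
Proof. by apply/fsfunP => n; rewrite laurent_of_intE !laurent0E. Qed.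

Lemma laurent_of_intB f g :
  laurent_of_int k (f - g) = laurent_of_int k f - laurent_of_int k g.
Proof.
apply/fsfunP => n.
by rewrite laurent_coefB !laurent_of_intE [X in X%:~R]laurent_addE laurent_oppE rmorphB.
Qed.

End LaurentRing.

Lemma laurent_of_int_mono (k : comNzRingType) a (f : laurent int) :
  laurent_of_int k ('h^a * f) = 'h^a * laurent_of_int k f.
Proof.
by apply/fsfunP => n; rewrite laurent_coefMmono !laurent_of_intE laurent_coefMmono.
Qed.

(** If the product vanishes, the coefficients of [f] have period two, which
finite support excludes. This makes the Alexander polynomial of a split link
vanish. *)
Lemma skein_coef_regular (f : laurent int) : ('h^(-1) - 'h^1) * f = 0 -> f = 0.
Proof.
move=> zf0.
have shift n : f n = f (n + 2).
  move/fsfunP: zf0 => /(_ (n + 1)); rewrite mulrBl laurent_coefB !laurent_coefMmono.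
  by rewrite laurent0E opprK addrK -addrA => /eqP; rewrite subr_eq0 => /eqP->.
have shifts (m : nat) n : f n = f (n + 2 * m%:Z).
  elim: m => [|m IHm]; first by rewrite mulr0 addr0.
  by rewrite IHm shift; congr (f _); lia.
apply/fsfunP => n; rewrite laurent0E.
(* A bound on the distance from [n] to the support, so that [n + 2 (m + 1)] lies
   outside it. *)
pose m := (\sum_(j <- finsupp f) `|(j - n)%R|%N)%N.
have suppP j : j \in finsupp f -> (`|(j - n)%R|%N <= m)%N.
  by move=> jS; rewrite /m (bigD1_seq j) ?fset_uniq //= leq_addr.
rewrite (shifts m.+1); case: finsuppP => // /suppP; lia.
Qed.

(** * Matrices up to a cast of their dimension *)

(** The dimensions [d ^ (m + n)] and [d ^ m * d ^ n] are equal but not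
convertible. With this relation between matrices of different types, the
tensor product is associative and unital and the casts disappear. *)
Definition mxeq (A : Type) m p (M : 'M[A]_m) (N : 'M[A]_p) :=
  exists e : m = p, castmx (e, e) M = N.
Local Notation "M =~ N" := (mxeq M N) (at level 70, no associativity).

Section MxEq.
Variable A : comNzRingType.

Lemma mxeqP m (M N : 'M[A]_m) : M =~ N -> M = N.
Proof. by case=> e; rewrite castmx_id. Qed.

Lemma mxeq_refl m (M : 'M[A]_m) : M =~ M.
Proof. by exists erefl; rewrite castmx_id. Qed.

Lemma mxeq_sym m p (M : 'M[A]_m) (N : 'M[A]_p) : M =~ N -> N =~ M.
Proof. by case=> e; case: p / e N => N <-; rewrite castmx_id; apply: mxeq_refl. Qed.

Lemma mxeq_trans m p q (N : 'M[A]_p) (M : 'M[A]_m) (L : 'M[A]_q) :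
  M =~ N -> N =~ L -> M =~ L.
Proof. by case=> e; case: p / e N => N <-; rewrite castmx_id. Qed.

Lemma mxeq_cast m p (e e' : m = p) (M : 'M[A]_m) : castmx (e, e') M =~ M.
Proof.
by case: p / e e' => e'; rewrite castmx_id; apply: mxeq_refl.
Qed.

Lemma mxeqM m p (M N : 'M[A]_m) (M' N' : 'M[A]_p) :
  M =~ M' -> N =~ N' -> M *m N =~ M' *m N'.
Proof.
case=> e; case: p / e M' N' => M' N' <- [e' <-].
by rewrite !castmx_id; apply: mxeq_refl.
Qed.

Lemma mxeqT m m' p p' (M : 'M[A]_m) (N : 'M[A]_p) (M' : 'M[A]_m') (N' : 'M[A]_p') :
  M =~ M' -> N =~ N' -> M *t N =~ M' *t N'.
Proof.
case=> e; case: m' / e M' => M' <- [e']; case: p' / e' N' => N' <-.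
by rewrite !castmx_id; apply: mxeq_refl.
Qed.

Lemma mxeq1 m p : m = p -> (1%:M : 'M[A]_m) =~ (1%:M : 'M_p).
Proof. by case: p /; apply: mxeq_refl. Qed.

Lemma mxeq_entry m p (M : 'M[A]_m) (N : 'M[A]_p) (i j : 'I_m) (i' j' : 'I_p) :
  M =~ N -> i = i' :> nat -> j = j' :> nat -> M i j = N i' j'.
Proof.
case=> e; case: p / e N i' j' => N i' j' <- /val_inj-> /val_inj->.
by rewrite castmx_id.
Qed.

Lemma mxeqI m p (M : 'M[A]_m) (N : 'M[A]_p) : m = p ->
  (forall (i j : 'I_m) (i' j' : 'I_p), i = i' :> nat -> j = j' :> nat -> M i j = N i' j') -> M =~ N.
Proof.
move=> e; case: p / e N => N MN; suff -> : M = N by apply: mxeq_refl.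
by apply/matrixP => i j; apply: MN.
Qed.

Lemma tensmx11 m p : (1%:M : 'M[A]_m) *t (1%:M : 'M_p) = 1%:M.
Proof.
apply/matrixP => i j; case: (mxtens_indexP i) => a b; case: (mxtens_indexP j) => c d.
rewrite tensmxE !mxE (can_eq (@mxtens_indexK _ _)) xpair_eqE.
by case: (a == c); rewrite ?mul1r ?mul0r.
Qed.

Lemma mxeq_tensA m p q (M : 'M[A]_m) (N : 'M[A]_p) (L : 'M[A]_q) :
  M *t N *t L =~ M *t (N *t L).
Proof.
apply: mxeqI => [|i j i' j']; first by rewrite mulnA.
case: (mxtens_indexP i) => ii c; case: (mxtens_indexP ii) => a b {i ii}.
case: (mxtens_indexP j) => ii f; case: (mxtens_indexP ii) => d e {j ii}.
move=> i'E j'E.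
have -> : i' = mxtens_index (a, mxtens_index (b, c)).
  by apply: ord_inj; rewrite -i'E /= mulnDl -mulnA addnA.
have -> : j' = mxtens_index (d, mxtens_index (e, f)).
  by apply: ord_inj; rewrite -j'E /= mulnDl -mulnA addnA.
by rewrite !tensmxE mulrA.
Qed.

Lemma mxeq_tens1l m (M : 'M[A]_m) : (1%:M : 'M_1) *t M =~ M.
Proof. by rewrite tens_scalar_mx scale1r; apply: mxeq_cast. Qed.

Lemma mxeq_tens1r m (M : 'M[A]_m) : M *t (1%:M : 'M_1) =~ M.
Proof. by rewrite tens_mx_scalar scale1r; apply: mxeq_cast. Qed.

Lemma mxeq_tens11 m p q : q = (m * p)%N ->
  (1%:M : 'M[A]_m) *t (1%:M : 'M_p) =~ (1%:M : 'M_q).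
Proof. by move->; rewrite tensmx11; apply: mxeq_refl. Qed.

End MxEq.

(** * Local operators and the braid representation *)

Section LocalOp.
Variables (A : comNzRingType) (d : nat).
Implicit Types R S : 'M[A]_(d * d).

Lemma local_op_tens n R (i : 'I_n) :
  local_op R i =~ (1%:M : 'M_(d ^ i)) *t R *t (1%:M : 'M_(d ^ (n - i.+1))).
Proof. exact: mxeq_cast. Qed.

Lemma local_opM n R S (i : 'I_n) : local_op R i *m local_op S i = local_op (R *m S) i.
Proof.
apply: mxeqP; apply: mxeq_trans (mxeqM (local_op_tens _ _) (local_op_tens _ _)) _.
by rewrite !tensmx_mul !mulmx1; apply/mxeq_sym/local_op_tens.
Qed.

Lemma local_op1 n (i : 'I_n) : local_op (1%:M : 'M[A]_(d * d)) i = 1%:M.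
Proof.
apply: mxeqP; apply: mxeq_trans (local_op_tens _ _) _; rewrite !tensmx11.
exact/mxeq1/local_dim.
Qed.

Lemma local_opZB n (a b : A) R S (i : 'I_n) :
  local_op (a *: R - b *: S) i = a *: local_op R i - b *: local_op S i.
Proof.
apply/matrixP => x y; rewrite /local_op castmxE !mxE !castmxE !mxE.
ring.
Qed.

Lemma local_op_widen n R (i : 'I_n) :
  local_op R (widen_ord (leqnSn n) i) =~ local_op R i *t (1%:M : 'M_d).
Proof.
apply: mxeq_trans (local_op_tens _ _) _.
apply: mxeq_sym; apply: mxeq_trans (mxeqT (local_op_tens _ _) (mxeq_refl _)) _.
apply: mxeq_trans (mxeq_tensA _ _ _) _; apply: mxeqT; first exact: mxeq_refl.
by apply: mxeq_tens11; rewrite subSS -expnSr -subSn // ltn_ord.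
Qed.

Lemma local_op_max n R :
  local_op R (@ord_max n) =~ (1%:M : 'M_(d ^ n)) *t R.
Proof.
apply: mxeq_trans (local_op_tens _ _) _.
apply: mxeq_trans (mxeq_tens1r _); apply: mxeqT; first exact: mxeq_refl.
by apply: mxeq1; rewrite /= subnn.
Qed.

(** Cut the tensor power before the factors of [j]: one operator lives on the
left part, the other on the right part. *)
Lemma local_op_far n R S (i j : 'I_n) : (i.+1 < j)%N ->
  local_op R i *m local_op S j = local_op S j *m local_op R i.
Proof.
move=> ltij.
pose X := (1%:M : 'M[A]_(d ^ i)) *t R *t (1%:M : 'M_(d ^ (j - i.+2))).
pose Y := S *t (1%:M : 'M[A]_(d ^ (n - j.+1))).
have dimX : (d ^ i * (d * d) * d ^ (j - i.+2) = d ^ j)%N.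
  by rewrite mulnn -!expnD addn2 subnKC.
have Xi : local_op R i =~ X *t (1%:M : 'M_((d * d) * d ^ (n - j.+1))).
  apply: mxeq_trans (local_op_tens _ _) _; apply: mxeq_sym.
  apply: mxeq_trans (mxeq_tensA _ _ _) _; apply: mxeqT; first exact: mxeq_refl.
  apply: mxeq_tens11; rewrite mulnn -!expnD; congr (d ^ _)%N.
  by move: (ltn_ord j) ltij; lia.
have Yj : local_op S j =~ (1%:M : 'M_(d ^ i * (d * d) * d ^ (j - i.+2))) *t Y.
  apply: mxeq_trans (local_op_tens _ _) _; apply: mxeq_trans (mxeq_tensA _ _ _) _.
  by apply: mxeqT; [apply: mxeq1 | apply: mxeq_refl].
apply: mxeqP; apply: mxeq_trans (mxeqM Xi Yj) _.
rewrite tensmx_mul mulmx1 mul1mx; apply: mxeq_sym.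
by apply: mxeq_trans (mxeqM Yj Xi) _; rewrite tensmx_mul mulmx1 mul1mx; apply: mxeq_refl.
Qed.

(** Both operators act on the same three consecutive factors, where the relation
is the Yang-Baxter equation. *)
Lemma local_op_braid n R (i j : 'I_n) : pre_YBO R -> j = i.+1 :> nat ->
  local_op R i *m local_op R j *m local_op R i
  = local_op R j *m local_op R i *m local_op R j.
Proof.
rewrite /pre_YBO; set R12 := R *t _; set R23 := castmx _ _ => ybe ij.
pose L (T : 'M[A]_(d * d * d)) :=
  (1%:M : 'M[A]_(d ^ i)) *t (T *t (1%:M : 'M[A]_(d ^ (n - j.+1)))).
have LM T U : L T *m L U = L (T *m U) by rewrite !tensmx_mul !mulmx1.
have Li : local_op R i =~ L R12.
  apply: mxeq_trans (local_op_tens _ _) _; apply: mxeq_trans (mxeq_tensA _ _ _) _.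
  apply: mxeqT; first exact: mxeq_refl.
  apply: mxeq_sym; apply: mxeq_trans (mxeq_tensA _ _ _) _.
  apply: mxeqT; first exact: mxeq_refl.
  apply: mxeq_tens11; rewrite -expnS; congr (d ^ _)%N.
  by move: (ltn_ord j) ij; lia.
have Lj : local_op R j =~ L R23.
  apply: mxeq_trans (local_op_tens _ _) _; apply: mxeq_trans (mxeq_tensA _ _ _) _.
  apply: mxeq_sym; rewrite /L.
  apply: mxeq_trans (mxeqT (mxeq_refl _) (mxeqT (mxeq_cast _ _ _) (mxeq_refl _))) _.
  apply: mxeq_trans (mxeqT (mxeq_refl _) (mxeq_tensA _ _ _)) _.
  apply: mxeq_trans (mxeq_sym (mxeq_tensA _ _ _)) _.
  apply: mxeqT; last exact: mxeq_refl.
  by apply: mxeq_tens11; rewrite ij expnSr.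
apply: mxeqP; apply: mxeq_trans (mxeqM (mxeqM Li Lj) Li) _.
apply: mxeq_sym; apply: mxeq_trans (mxeqM (mxeqM Lj Li) Lj) _.
by rewrite !LM ybe; apply: mxeq_refl.
Qed.

End LocalOp.

Section BraidRep.
Variables (A : comNzRingType) (d : nat) (R R' : 'M[A]_(d * d)).

Lemma braid_rep_nil n : braid_rep R R' ([::] : braid n) = 1%:M.
Proof. by rewrite /braid_rep big_nil. Qed.

Lemma braid_rep_cons n c (b : braid n) :
  braid_rep R R' (c :: b) = local_op (if c.2 then R else R') c.1 *m braid_rep R R' b.
Proof. by rewrite /braid_rep big_cons. Qed.

Lemma braid_rep_cat n (u v : braid n) :
  braid_rep R R' (u ++ v) = braid_rep R R' u *m braid_rep R R' v.
Proof.
elim: u => [|c u IHu]; first by rewrite braid_rep_nil mul1mx.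
by rewrite cat_cons !braid_rep_cons IHu mulmxA.
Qed.

Lemma braid_rep_add_strand n (b : braid n) :
  braid_rep R R' (add_strand b) =~ braid_rep R R' b *t (1%:M : 'M_d).
Proof.
elim: b => [|c b IHb].
  by rewrite !braid_rep_nil; apply/mxeq_sym/mxeq_tens11; rewrite -expnSr.
rewrite !braid_rep_cons; apply: mxeq_trans (mxeqM (local_op_widen _ _) IHb) _.
by rewrite tensmx_mul mulmx1; apply: mxeq_refl.
Qed.

End BraidRep.

(** * Partial traces *)

Section PartialTrace.
Variable A : comNzRingType.

(** The partial trace over the right factor of a tensor product. Iterating it
removes the strands of a braid from the last one on, as the induction requires,
whereas [ptrace] removes all but the first at once. *)
Definition ptrace_last m p (M : 'M[A]_(m * p)) : 'M[A]_m :=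
  \matrix_(i, j) \sum_(l < p) M (mxtens_index (i, l)) (mxtens_index (j, l)).

Lemma mxeq_ptrace_last m m' p p' (M : 'M[A]_(m * p)) (N : 'M[A]_(m' * p')) :
  m = m' -> p = p' -> M =~ N -> ptrace_last M =~ ptrace_last N.
Proof.
move=> e; case: m' / e N => N e; case: p' / e N => N /mxeqP->.
exact: mxeq_refl.
Qed.

Lemma sum_mxtens (m p : nat) (F : 'I_(m * p) -> A) :
  \sum_l F l = \sum_(i < m) \sum_(j < p) F (mxtens_index (i, j)).
Proof.
rewrite pair_big /= (reindex (@mxtens_index m p)) /=; first by apply: eq_bigr => -[].
by exists (@mxtens_unindex m p) => x _; rewrite (mxtens_indexK, mxtens_unindexK).
Qed.

(** The partial trace is a bimodule map over the operators on the factor that it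
keeps; this lets the part of a braid word without the last generator pass
through it. *)
Lemma ptrace_lastM m p (X Y : 'M[A]_m) (M : 'M[A]_(m * p)) :
  ptrace_last ((X *t 1%:M) *m M *m (Y *t 1%:M)) = X *m ptrace_last M *m Y.
Proof.
have one_r (l : 'I_p) (F : 'I_p -> A) : \sum_(c < p) F c * (1%:M : 'M_p) c l = F l.
  rewrite (bigD1 l) //= mxE eqxx mulr1 big1 ?addr0 // => c cl.
  by rewrite mxE (negPf cl) mulr0.
have one_l (l : 'I_p) (F : 'I_p -> A) : \sum_(c < p) (1%:M : 'M_p) l c * F c = F l.
  rewrite -[RHS](one_r l F); apply: eq_bigr => c _; rewrite mulrC.
  by rewrite !mxE eq_sym.
apply/matrixP => i j; rewrite !mxE.
under eq_bigr => l _.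
  rewrite mxE sum_mxtens.
  under eq_bigr => b _.
    under eq_bigr => c _ do rewrite tensmxE mulrA.
    rewrite one_r mxE sum_mxtens.
    under eq_bigr => a _.
      under eq_bigr => c _ do rewrite tensmxE [X i a * _]mulrC -mulrA.
      rewrite one_l; over.
    over.
  over.
rewrite exchange_big; apply: eq_bigr => b _ /=.
rewrite -mulr_suml mxE; congr (_ * _); rewrite exchange_big /=.
by apply: eq_bigr => a _; rewrite !mxE mulr_sumr.
Qed.

Lemma ptrace_last_last m p q (M : 'M[A]_(m * (p * q))) (N : 'M[A]_(m * p * q)) :
  M =~ N -> ptrace_last M = ptrace_last (ptrace_last N).
Proof.
move=> MN; apply/matrixP => i j; rewrite !mxE sum_mxtens; apply: eq_bigr => a _.
rewrite mxE; apply: eq_bigr => b _.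
by apply: (mxeq_entry MN); rewrite /= mulnDl -mulnA addnA.
Qed.

Lemma ptrace_last_tens1 m p q (M : 'M[A]_(p * q)) (N : 'M[A]_(m * p * q)) :
  (1%:M : 'M_m) *t M =~ N -> ptrace_last N = (1%:M : 'M_m) *t ptrace_last M.
Proof.
move=> MN; apply/matrixP => i j.
case: (mxtens_indexP i) => a b; case: (mxtens_indexP j) => c e {i j}.
rewrite tensmxE !mxE mulr_sumr; apply: eq_bigr => l _.
rewrite -[RHS](_ : (1%:M *t M) (mxtens_index (a, mxtens_index (b, l)))
  (mxtens_index (c, mxtens_index (e, l))) = _); last by rewrite tensmxE mxE.
by symmetry; apply: (mxeq_entry MN); rewrite /= mulnDl -mulnA addnA.
Qed.

Lemma ptrace_last_tens m p (M : 'M[A]_m) (N : 'M[A]_p) : ptrace_last (M *t N) = \tr N *: M.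
Proof.
apply/matrixP => i j; rewrite !mxE mulr_suml; apply: eq_bigr => l _.
by rewrite tensmxE mulrC.
Qed.

Variable d : nat.

Lemma ptraceS n (M : 'M[A]_(d ^ n.+2)) (N : 'M[A]_(d ^ n.+1 * d)) :
  M =~ N -> ptrace M = ptrace (ptrace_last N).
Proof.
move=> MN; rewrite -[LHS]/(ptrace_last _) -[RHS]/(ptrace_last _).
have eN : (d ^ n.+1 * d = d * d ^ n * d)%N by rewrite expnS.
have eM : (d ^ n.+2 = d * (d ^ n * d))%N by rewrite -expnSr -expnS.
transitivity (ptrace_last (castmx (eM, eM) M)).
  apply/mxeqP/mxeq_ptrace_last => //; first by rewrite expnSr.
  exact: mxeq_trans (mxeq_cast _ _ _) (mxeq_sym (mxeq_cast _ _ _)).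
rewrite (@ptrace_last_last _ _ _ _ (castmx (eN, eN) N)); last first.
  exact: mxeq_trans (mxeq_trans (mxeq_cast _ _ _) MN) (mxeq_sym (mxeq_cast _ _ _)).
congr ptrace_last; apply: mxeqP; apply: mxeq_trans (mxeq_sym (mxeq_cast _ _ _)).
by apply: mxeq_ptrace_last; rewrite ?expnS //; apply: mxeq_cast.
Qed.

Lemma ntensmxSr n (mu : 'M[A]_d) : mu ^t n.+1 =~ mu ^t n *t mu.
Proof.
elim: n => [|n IHn]; first by apply: mxeq_sym; apply: mxeq_tens1l.
rewrite ntensmxSS; apply: mxeq_trans (mxeqT (mxeq_refl _) IHn) _.
apply: mxeq_trans (mxeq_sym (mxeq_tensA _ _ _)) _.
apply: mxeqT; last exact: mxeq_refl.
case: n {IHn} => [|n]; last exact: mxeq_refl.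
exact: mxeq_tens1r.
Qed.

Lemma id_tensS n (mu : 'M[A]_d) : id_tens n.+1 mu =~ id_tens n mu *t mu.
Proof.
apply: mxeq_trans (mxeq_cast _ _ _) _.
apply: mxeq_trans (mxeqT (mxeq_refl _) (ntensmxSr _ _)) _.
apply: mxeq_trans (mxeq_sym (mxeq_tensA _ _ _)) _.
by apply: mxeqT; [apply: mxeq_sym; apply: mxeq_cast | apply: mxeq_refl].
Qed.

(** Closing the last strand of a braid in which an operator [T] on the last two
strands occurs once. With [T] the R-matrix this is Markov stabilisation; with
[T] the identity it closes a strand that splits off. *)
Lemma ptrace_markov n (mu : 'M[A]_d) (T : 'M[A]_(d * d)) (c : A)
    (X Y : 'M[A]_(d ^ n.+1)) (X' Y' : 'M[A]_(d ^ n.+2)) :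
  ptrace_last (T *m (1%:M *t mu)) = c%:M ->
  X' =~ X *t (1%:M : 'M_d) -> Y' =~ Y *t (1%:M : 'M_d) ->
  ptrace (X' *m local_op T ord_max *m Y' *m id_tens n.+1 mu)
  = c *: ptrace (X *m Y *m id_tens n mu).
Proof.
move=> Tc XX YY; have eL : (d ^ n.+2 = d ^ n.+1 * d)%N by rewrite -expnSr.
pose L := castmx (eL, eL) (local_op T (@ord_max n)).
have LL : local_op T (@ord_max n) =~ L by apply: mxeq_sym; apply: mxeq_cast.
rewrite (ptraceS (mxeqM (mxeqM (mxeqM XX LL) YY) (id_tensS n mu))).
have -> : X *t 1%:M *m L *m (Y *t 1%:M) *m (id_tens n mu *t mu)
    = X *t 1%:M *m (L *m (1%:M *t mu)) *m ((Y *m id_tens n mu) *t 1%:M).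
  by rewrite -!mulmxA; congr (_ *m (_ *m _)); rewrite !tensmx_mul !mul1mx !mulmx1.
rewrite ptrace_lastM.
have -> : ptrace_last (L *m (1%:M *t mu)) = c%:M.
  have e : (d ^ n.+1 * d = d ^ n * d * d)%N by rewrite expnSr.
  pose N := castmx (e, e) (L *m (1%:M *t mu)).
  have NE : (1%:M : 'M_(d ^ n)) *t (T *m (1%:M *t mu)) =~ N.
    apply: mxeq_sym; apply: mxeq_trans (mxeq_cast _ _ _) _.
    have -> : (1%:M : 'M_(d ^ n)) *t (T *m (1%:M *t mu)) =
        ((1%:M : 'M_(d ^ n)) *t T) *m ((1%:M : 'M_(d ^ n)) *t (1%:M *t mu)).
      by rewrite tensmx_mul mulmx1.
    apply: mxeqM; first exact: mxeq_trans (mxeq_cast _ _ _) (local_op_max _ _).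
    apply: mxeq_trans (mxeq_tensA _ _ _); apply: mxeqT; last exact: mxeq_refl.
    by apply/mxeq_sym/mxeq_tens11; rewrite expnSr.
  apply: mxeqP; apply: (@mxeq_trans _ _ _ _ (ptrace_last N)).
    by apply: mxeq_ptrace_last; rewrite ?expnSr //; apply: mxeq_sym; apply: mxeq_cast.
  rewrite (ptrace_last_tens1 NE) Tc -[c%:M]scalemx1.
  have -> : (1%:M : 'M_(d ^ n)) *t (c *: 1%:M) = (c%:M : 'M[A]_(d ^ n * d)).
    apply/matrixP => i j.
    case: (mxtens_indexP i) => a b; case: (mxtens_indexP j) => a' b' {i j}.
    rewrite tensmxE !mxE (can_eq (@mxtens_indexK _ _)) xpair_eqE.
    by case: (a == a'); case: (b == b') => //=; rewrite ?(mul1r, mulr1, mul0r, mulr0).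
  by rewrite expnSr; apply: mxeq_refl.
rewrite mul_mx_scalar -scalemxAl !mulmxA.
apply/matrixP => i j; rewrite !mxE mulr_sumr; apply: eq_bigr => l _.
by rewrite !castmxE !mxE.
Qed.

Lemma ptraceZB n (a b : A) (M N : 'M[A]_(d ^ n.+1)) :
  ptrace (a *: M - b *: N) = a *: ptrace M - b *: ptrace N.
Proof.
apply/matrixP => i j; rewrite !mxE !mulr_sumr -sumrB.
by apply: eq_bigr => l _; rewrite !castmxE !mxE.
Qed.

Lemma ptrace_id_tens0 (mu : 'M[A]_d) : ptrace (1%:M *m id_tens 0 mu) = 1%:M.
Proof.
rewrite mul1mx -[LHS]/(ptrace_last _).
transitivity (ptrace_last ((1%:M : 'M[A]_d) *t (1%:M : 'M_1))).
  apply/mxeqP/mxeq_ptrace_last => //.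
  exact: mxeq_trans (mxeq_cast _ _ _) (mxeq_cast _ _ _).
by rewrite ptrace_last_tens mxtrace1 scale1r.
Qed.

End PartialTrace.

(** * The R-matrix *)

Section RMatrix.
Variable A : comNzRingType.
Implicit Types h : A.

Local Notation E a b := (delta_mx a b : 'M_2).

(** The R-matrix of the vector representation of the quantum supergroup of
gl(1|1), in its bosonic form, scaled so that its eigenvalues are [1] and
[- h ^+ 2]. *)
Definition alexander_R h : 'M[A]_(2 * 2) :=
  1%:M *t E 0 0 + h *: (E 0 1 *t E 1 0 + E 1 0 *t E 0 1) - h ^+ 2 *: (E 1 1 *t 1%:M).

(** The conjugate of [alexander_R h] by the flip of the two factors. It is the
inverse of [alexander_R] at the inverse parameter, but it is defined for every
[h], invertible or not: the truncated deformations need a nilpotent one. *)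
Definition alexander_R' h : 'M[A]_(2 * 2) :=
  E 0 0 *t 1%:M + h *: (E 0 1 *t E 1 0 + E 1 0 *t E 0 1) - h ^+ 2 *: (1%:M *t E 1 1).

Definition alexander_mu : 'M[A]_2 := E 0 0 - E 1 1.

Lemma ord2_ind (P : 'I_2 -> Prop) : P 0 -> P 1 -> forall i, P i.
Proof.
by move=> P0 P1 [[|[|//]] i2]; [move: P0 | move: P1]; congr P; apply: val_inj.
Qed.

Lemma big_ord2 (F : 'I_2 -> A) : \sum_i F i = F 0 + F 1.
Proof.
by rewrite big_ord_recl big_ord1; congr (F _ + F _); apply: val_inj.
Qed.

Lemma mulR12E (R : 'M[A]_(2 * 2)) (M : 'M[A]_(2 * 2 * 2)) (a b c : 'I_2) j :
  (R *t (1%:M : 'M_2) *m M) (mxtens_index (mxtens_index (a, b), c)) j =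
  \sum_x \sum_y R (mxtens_index (a, b)) (mxtens_index (x, y))
    * M (mxtens_index (mxtens_index (x, y), c)) j.
Proof.
rewrite mxE sum_mxtens sum_mxtens; apply: eq_bigr => x _; apply: eq_bigr => y _.
rewrite (bigD1 c) //= tensmxE mxE eqxx mulr1 big1 ?addr0 // => e ec.
by rewrite tensmxE mxE eq_sym (negPf ec) mulr0 mul0r.
Qed.

Lemma R23E (R : 'M[A]_(2 * 2)) (a b c x y e : 'I_2) :
  castmx (mulnA 2 2 2, mulnA 2 2 2) ((1%:M : 'M_2) *t R)
    (mxtens_index (mxtens_index (a, b), c)) (mxtens_index (mxtens_index (x, y), e))
  = (a == x)%:R * R (mxtens_index (b, c)) (mxtens_index (y, e)).
Proof.
rewrite (@mxeq_entry _ _ _ _ _ _ _ (mxtens_index (a, mxtens_index (b, c)))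
    (mxtens_index (x, mxtens_index (y, e))) (mxeq_cast _ _ _)).
- by rewrite tensmxE mxE.
- by rewrite /= mulnDl -mulnA addnA.
- by rewrite /= mulnDl -mulnA addnA.
Qed.

Lemma mulR23E (R : 'M[A]_(2 * 2)) (M : 'M[A]_(2 * 2 * 2)) (a b c : 'I_2) j :
  (castmx (mulnA 2 2 2, mulnA 2 2 2) ((1%:M : 'M_2) *t R) *m M)
    (mxtens_index (mxtens_index (a, b), c)) j =
  \sum_x \sum_y R (mxtens_index (b, c)) (mxtens_index (x, y))
    * M (mxtens_index (mxtens_index (a, x), y)) j.
Proof.
rewrite mxE sum_mxtens sum_mxtens (bigD1 a) //= [X in _ + X]big1 ?addr0 => [|x xa].
  by apply: eq_bigr => x _; apply: eq_bigr => y _; rewrite R23E eqxx mul1r.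
rewrite big1 // => y _; rewrite big1 // => e _.
by rewrite R23E eq_sym (negPf xa) mul0r mul0r.
Qed.

Definition YBE_entries (r : 'I_2 -> 'I_2 -> 'I_2 -> 'I_2 -> A) :=
  forall a b c a' b' c' : 'I_2,
  \sum_x \sum_y r a b x y * (\sum_z \sum_w r y c z w * (r x z a' b' * (w == c')%:R))
  = \sum_x \sum_y r b c x y * (\sum_z \sum_w r a x z w * ((z == a')%:R * r w y b' c')).

(** Read the equation in the basis of the [e_a (x) e_b (x) e_c], so that for a
concrete operator it becomes finitely many polynomial identities. *)
Lemma pre_YBO_entries (R : 'M[A]_(2 * 2)) r :
  (forall a b c d, R (mxtens_index (a, b)) (mxtens_index (c, d)) = r a b c d) ->
  YBE_entries r -> pre_YBO R.
Proof.
move=> Rr ybe; rewrite /pre_YBO -!mulmxA; apply/matrixP => i j.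
case: (mxtens_indexP i) => ii c; case: (mxtens_indexP ii) => a b {i ii}.
case: (mxtens_indexP j) => jj c'; case: (mxtens_indexP jj) => a' b' {j jj}.
transitivity (\sum_x \sum_y r a b x y *
    (\sum_z \sum_w r y c z w * (r x z a' b' * (w == c')%:R))).
  rewrite mulR12E; apply: eq_bigr => x _; apply: eq_bigr => y _.
  rewrite Rr mulR23E; congr (_ * _); apply: eq_bigr => z _; apply: eq_bigr => w _.
  by rewrite Rr tensmxE Rr mxE.
rewrite ybe mulR23E; apply: eq_bigr => x _; apply: eq_bigr => y _.
rewrite Rr mulR12E; congr (_ * _); apply: eq_bigr => z _; apply: eq_bigr => w _.
by rewrite Rr R23E Rr.
Qed.

(** Reversing the order of the three tensor factors exchanges the two sides of
the Yang-Baxter equation. *)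
Lemma YBE_entries_flip r : YBE_entries r -> YBE_entries (fun a b c d => r b a d c).
Proof.
move=> ybe a b c a' b' c'; rewrite exchange_big [RHS]exchange_big /=.
transitivity (\sum_x \sum_y r b a x y *
    (\sum_z \sum_w r c x z w * ((z == c')%:R * r w y b' a'))).
  apply: eq_bigr => x _; apply: eq_bigr => y _; congr (_ * _).
  by rewrite exchange_big; apply: eq_bigr => z _; apply: eq_bigr => w _; congr (_ * _); rewrite mulrC.
rewrite -ybe; apply: eq_bigr => x _; apply: eq_bigr => y _; congr (_ * _).
by rewrite exchange_big; apply: eq_bigr => z _; apply: eq_bigr => w _; congr (_ * _); rewrite mulrC.
Qed.

Definition alexander_entry h (a b c d : 'I_2) : A :=
  ((a == c) && (b == 0) && (d == 0))%:R
  + h * (((a == 0) && (b == 1) && (c == 1) && (d == 0))%:R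
       + ((a == 1) && (b == 0) && (c == 0) && (d == 1))%:R)
  - h ^+ 2 * ((a == 1) && (c == 1) && (b == d))%:R.

Lemma alexander_RE h (a b c d : 'I_2) :
  alexander_R h (mxtens_index (a, b)) (mxtens_index (c, d)) = alexander_entry h a b c d.
Proof.
rewrite !mxE !mxtens_indexK /alexander_entry.
by elim/ord2_ind: a; elim/ord2_ind: b; elim/ord2_ind: c; elim/ord2_ind: d => /=; ring.
Qed.

Lemma alexander_R'E h (a b c d : 'I_2) :
  alexander_R' h (mxtens_index (a, b)) (mxtens_index (c, d)) = alexander_entry h b a d c.
Proof.
rewrite !mxE !mxtens_indexK /alexander_entry.
by elim/ord2_ind: a; elim/ord2_ind: b; elim/ord2_ind: c; elim/ord2_ind: d => /=; ring.
Qed.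

Lemma alexander_entry_YBE h : YBE_entries (alexander_entry h).
Proof.
move=> a b c a' b' c'; rewrite !big_ord2 /alexander_entry.
by elim/ord2_ind: a; elim/ord2_ind: b; elim/ord2_ind: c;
  elim/ord2_ind: a'; elim/ord2_ind: b'; elim/ord2_ind: c' => /=; ring.
Qed.

Lemma alexander_R_YBO h : pre_YBO (alexander_R h).
Proof. exact: pre_YBO_entries (alexander_RE h) (alexander_entry_YBE h). Qed.

Lemma alexander_R'_YBO h : pre_YBO (alexander_R' h).
Proof.
apply: pre_YBO_entries (alexander_R'E h) _.
exact: YBE_entries_flip (alexander_entry_YBE h).
Qed.

Lemma mulmx4E (R S : 'M[A]_(2 * 2)) a b j :
  (R *m S) (mxtens_index (a, b)) j =
  \sum_x \sum_y R (mxtens_index (a, b)) (mxtens_index (x, y)) * S (mxtens_index (x, y)) j.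
Proof. by rewrite mxE sum_mxtens. Qed.

Lemma scalar_mx4E (c : A) (a b a' b' : 'I_2) :
  (c%:M : 'M_(2 * 2)) (mxtens_index (a, b)) (mxtens_index (a', b'))
  = c * ((a == a') && (b == b'))%:R.
Proof. by rewrite mxE (can_eq (@mxtens_indexK _ _)) xpair_eqE mulr_natr. Qed.

(** The quadratic relation of the Hecke algebra, (R - 1)(R + h^2) = 0. *)
Lemma alexander_R_sqr h :
  alexander_R h *m alexander_R h = (1 - h ^+ 2) *: alexander_R h + (h ^+ 2)%:M.
Proof.
apply/matrixP => i j; case: (mxtens_indexP i) => a b; case: (mxtens_indexP j) => a' b' {i j}.
rewrite mulmx4E [RHS]mxE [((_ *: _) : 'M_ _) _ _]mxE scalar_mx4E !big_ord2 !alexander_RE /alexander_entry.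
elim/ord2_ind: a; elim/ord2_ind: b; elim/ord2_ind: a'; elim/ord2_ind: b' => /=; ring.
Qed.

(** The quadratic relation solved for the inverse. *)
Lemma alexander_R'_affine h h' : h * h' = 1 ->
  alexander_R' h' = h' ^+ 2 *: alexander_R h + (1 - h' ^+ 2)%:M.
Proof.
move=> hh; apply/matrixP => i j.
case: (mxtens_indexP i) => a b; case: (mxtens_indexP j) => a' b' {i j}.
rewrite [RHS]mxE [((_ *: _) : 'M_ _) _ _]mxE scalar_mx4E alexander_RE alexander_R'E.
have expand x y t : h' ^+ 2 * (x + h * y - h ^+ 2 * t) = h' ^+ 2 * x + h' * y - t.
  transitivity (h' ^+ 2 * x + h' * (h * h') * y - (h * h') ^+ 2 * t); first by ring.
  by rewrite hh expr1n mulr1 mul1r.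
rewrite /alexander_entry expand.
elim/ord2_ind: a; elim/ord2_ind: b; elim/ord2_ind: a'; elim/ord2_ind: b' => /=; ring.
Qed.

Lemma alexander_R_inv h h' : h * h' = 1 ->
  alexander_R h *m alexander_R' h' = 1%:M /\ alexander_R' h' *m alexander_R h = 1%:M.
Proof.
move=> hh; rewrite (alexander_R'_affine hh).
have hh2 : h' ^+ 2 * h ^+ 2 = 1 by rewrite -exprMn mulrC hh expr1n.
suff inv : h' ^+ 2 *: (alexander_R h *m alexander_R h) + (1 - h' ^+ 2) *: alexander_R h = 1%:M.
  split; rewrite -[RHS]inv.
    by rewrite mulmxDr -scalemxAr mul_mx_scalar.
  by rewrite mulmxDl -scalemxAl mul_scalar_mx.
rewrite alexander_R_sqr.
rewrite scalerDr scalerA addrAC -scalerDl mulrBr mulr1 hh2.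
by rewrite addrA subrK subrr scale0r add0r -[_%:M]scalemx1 scalerA hh2 scale1r.
Qed.

(** The diagonal entries [1], [0], [1 - h ^+ 2], [- h ^+ 2] of the R-matrix are
arranged so that weighting the second factor by [1], [-1] gives
[1 - 0 = (1 - h ^+ 2) + h ^+ 2]. *)
Lemma ptrace_last_alexander_R h : ptrace_last (alexander_R h *m (1%:M *t alexander_mu)) = 1%:M.
Proof.
apply/matrixP => i j; rewrite !mxE !big_ord2.
have E2 a b c d : ((1%:M : 'M_2) *t alexander_mu) (mxtens_index (a, b)) (mxtens_index (c, d))
   = ((a == c) && (b == 0) && (d == 0))%:R - ((a == c) && (b == 1) && (d == 1))%:R.
  rewrite tensmxE !mxE.
  by elim/ord2_ind: a; elim/ord2_ind: b; elim/ord2_ind: c; elim/ord2_ind: d => /=; ring.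
rewrite !mulmx4E !big_ord2 !alexander_RE !E2 /alexander_entry.
elim/ord2_ind: i; elim/ord2_ind: j => /=; ring.
Qed.

Lemma ptrace_last_alexander_mu : ptrace_last (1%:M *m (1%:M *t alexander_mu)) = 0%:M :> 'M_2.
Proof.
rewrite mul1mx ptrace_last_tens (_ : \tr _ = 0) ?scale0r ?scalemx0 //; last first.
  by rewrite /mxtrace big_ord2 !mxE /=; ring.
by apply/matrixP => i j; rewrite !mxE mul0rn.
Qed.

End RMatrix.

(** * The Laurent deformation *)

Lemma deform_truncate (k : comNzRingType) (A : comAlgType k) (h : A) e N
    (phi : 'I_N.+1 -> 'M[k]_e) n :
  h ^+ n.+1 = 0 -> deform h phi n = deform h phi N.
Proof.
move=> hn; rewrite /deform big_mkcond [RHS]big_mkcond; apply: eq_bigr => i _.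
rewrite (leq_ord i); case: leqP => // ni.
by rewrite -(subnKC ni) exprD hn mul0r scale0r.
Qed.

Lemma qpolyX_pow0 (k : comNzRingType) n :
  ('qX : {poly %/ ('X^(n.+1) : {poly k})}) ^+ n.+1 = 0.
Proof.
rewrite /qpolyX -rmorphXn; apply: val_inj => /=.
by rewrite mk_monic_Xn Pdiv.RingMonic.rmodpp // monicXn.
Qed.

Section Deformation.
Variable k : comNzRingType.
Local Notation E a b := (delta_mx a b : 'M[k]_2).

Definition alexander_phi (i : 'I_3) : 'M[k]_(2 * 2) :=
  nth 0 [:: 1%:M *t E 0 0; E 0 1 *t E 1 0 + E 1 0 *t E 0 1; - (E 1 1 *t 1%:M)] i.

Definition alexander_phi' (i : 'I_3) : 'M[k]_(2 * 2) :=
  nth 0 [:: E 0 0 *t 1%:M; E 0 1 *t E 1 0 + E 1 0 *t E 0 1; - (1%:M *t E 1 1)] i.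

(** Over any algebra: the element [h] is the Laurent variable in one use and a
nilpotent in the other. *)
Lemma deform_alexander (A : comAlgType k) (h : A) :
  deform h alexander_phi 2 = alexander_R h.
Proof.
rewrite /deform big_mkcond !big_ord_recl big_ord0 /= addr0 !expr0 expr1 scale1r.
rewrite map_mxN map_mxD !map_mxT !map_mx1 !map_delta_mx.
by rewrite addrA scalerN.
Qed.

Lemma deform_alexander' (A : comAlgType k) (h : A) :
  deform h alexander_phi' 2 = alexander_R' h.
Proof.
rewrite /deform big_mkcond !big_ord_recl big_ord0 /= addr0 !expr0 expr1 scale1r.
rewrite map_mxN map_mxD !map_mxT !map_mx1 !map_delta_mx.
by rewrite addrA scalerN.
Qed.

Lemma map_alexander_mu (A : comAlgType k) :
  map_mx (in_alg A) (alexander_mu k) = alexander_mu A.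
Proof. by rewrite map_mxB !map_delta_mx. Qed.

End Deformation.

(** * The normalised partial trace of a braid *)

Lemma crossings_cat n e (u v : braid n) :
  crossings e (u ++ v) = (crossings e u + crossings e v)%N.
Proof. exact: count_cat. Qed.

Lemma crossings_cons n e c (v : braid n) :
  crossings e (c :: v) = ((c.2 == e) + crossings e v)%N.
Proof. by []. Qed.

Lemma crossings_add_strand n e (b : braid n) : crossings e (add_strand b) = crossings e b.
Proof. by rewrite /crossings count_map. Qed.

Section AlexanderTrace.
(* [c n] stands for the [n]-th power of the variable. Only its being a morphism
   from the integers to the units matters, and leaving it abstract prevents
   Laurent polynomials from being unfolded when terms are compared. *)
Variables (A : comNzRingType) (c : int -> A).
Hypothesis c0 : c 0 = 1.
Hypothesis cD : forall a b, c (a + b) = c a * c b.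
Local Notation R := (alexander_R (c 1)).
Local Notation R' := (alexander_R' (c (-1))).
Local Notation mu := (alexander_mu A).
Local Notation z := (c (-1) - c 1).
Local Notation rep := (braid_rep R R').

Definition norm_exponent n (b : braid n) : int :=
  - (crossings true b)%:Z + (crossings false b)%:Z + n.+1%:Z - 1.

Definition alexander_trace n (b : braid n) : 'M[A]_2 :=
  c (norm_exponent b) *: ptrace (rep b *m id_tens n mu).

Lemma c1V : c 1 * c (-1) = 1.
Proof. by rewrite -cD. Qed.

Lemma alexander_trace_eq n (b b' : braid n) : rep b = rep b' ->
  (forall e, crossings e b = crossings e b') -> alexander_trace b = alexander_trace b'.
Proof. by rewrite /alexander_trace /norm_exponent => -> cE; rewrite !cE. Qed.

Lemma alexander_R_skein : c (-1) *: R - c 1 *: R' = c (-1) *: 1%:M - c 1 *: 1%:M.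
Proof.
rewrite (alexander_R'_affine c1V); move: R => S.
rewrite [_ *: (_ + _)]scalerDr scalerA expr2 mulrA c1V mul1r.
rewrite opprD addrA subrr sub0r -[(1 - _)%:M]scalemx1 scalerA mulrBr mulr1 mulrA c1V mul1r.
by rewrite -scaleNr opprB scalerBl.
Qed.

(** The skein relation of the operators, before normalisation by the writhe. *)
Lemma local_op_skein n (i : 'I_n) :
  c (-1) *: local_op R i - c 1 *: local_op R' i = z *: 1%:M.
Proof. by rewrite -local_opZB alexander_R_skein local_opZB !local_op1 scalerBl. Qed.

Lemma alexander_trace_skein n (u v : braid n) i :
  alexander_trace (u ++ (i, true) :: v) - alexander_trace (u ++ (i, false) :: v)
  = z *: alexander_trace (u ++ v).
Proof.
have eT : norm_exponent (u ++ (i, true) :: v) = norm_exponent (u ++ v) - 1.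
  by rewrite /norm_exponent !crossings_cat !crossings_cons /=; lia.
have eF : norm_exponent (u ++ (i, false) :: v) = norm_exponent (u ++ v) + 1.
  by rewrite /norm_exponent !crossings_cat !crossings_cons /=; lia.
rewrite /alexander_trace eT eF; move: (norm_exponent _) => e.
rewrite !cD -!scalerA -scalerBr -ptraceZB.
rewrite scalerA [z * _]mulrC -scalerA; congr (_ *: _).
rewrite -[RHS]subr0 -[X in _ = _ - X](scale0r (ptrace (rep (u ++ v)))) -ptraceZB scale0r subr0.
congr ptrace.
rewrite !braid_rep_cat !braid_rep_cons /=; move: (rep u) (rep v) (id_tens n mu) => U V W.
have scal a M : a *: (U *m (M *m V) *m W) = U *m ((a *: M) *m V) *m W.
  by rewrite -scalemxAl -scalemxAr -scalemxAl.
rewrite !scal -mulmxBl -mulmxBr -mulmxBl local_op_skein.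
by rewrite -scalemxAl mul1mx -scalemxAr -scalemxAl.
Qed.

Lemma alexander_trace_far n (u v : braid n) (i j : 'I_n) : (i.+1 < j)%N ->
  alexander_trace (u ++ (i, true) :: (j, true) :: v)
  = alexander_trace (u ++ (j, true) :: (i, true) :: v).
Proof.
move=> ij; apply: alexander_trace_eq => [|e].
  by rewrite !braid_rep_cat !braid_rep_cons /= !(mulmxA (local_op _ _)) local_op_far.
by rewrite !crossings_cat !crossings_cons.
Qed.

Lemma alexander_trace_braid n (u v : braid n) (i j : 'I_n) : j = i.+1 :> nat ->
  alexander_trace (u ++ (i, true) :: (j, true) :: (i, true) :: v)
  = alexander_trace (u ++ (j, true) :: (i, true) :: (j, true) :: v).
Proof.
move=> ij; apply: alexander_trace_eq => [|e].
  rewrite !braid_rep_cat !braid_rep_cons /=; congr (_ *m _).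
  by rewrite !mulmxA (local_op_braid (alexander_R_YBO _) ij).
by rewrite !crossings_cat !crossings_cons.
Qed.

Lemma alexander_trace_inv n (u v : braid n) (i : 'I_n) :
  alexander_trace (u ++ (i, false) :: (i, true) :: v) = alexander_trace (u ++ v).
Proof.
have eE : norm_exponent (u ++ (i, false) :: (i, true) :: v) = norm_exponent (u ++ v).
  by rewrite /norm_exponent !crossings_cat !crossings_cons /=; lia.
rewrite /alexander_trace eE; congr (_ *: ptrace _).
rewrite !braid_rep_cat !braid_rep_cons /= (mulmxA (local_op _ _)) local_opM.
by have [_ ->] := alexander_R_inv c1V; rewrite local_op1 mul1mx.
Qed.

Lemma alexander_trace_unknot : alexander_trace ([::] : braid 0) = 1%:M.
Proof.
by rewrite /alexander_trace braid_rep_nil ptrace_id_tens0 (_ : norm_exponent _ = 0) // c0 scale1r.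
Qed.

(** The extra strand and the extra crossing cancel in the exponent of the
normalisation, and closing the strand contributes the factor [1]. *)
Lemma alexander_trace_stab n (u v : braid n) :
  alexander_trace (add_strand u ++ (ord_max, true) :: add_strand v) = alexander_trace (u ++ v).
Proof.
rewrite /alexander_trace; have -> : norm_exponent (add_strand u ++ (ord_max, true) :: add_strand v)
    = norm_exponent (u ++ v).
  by rewrite /norm_exponent !crossings_cat !crossings_cons !crossings_add_strand /=; lia.
congr (_ *: _); rewrite !braid_rep_cat braid_rep_cons /= mulmxA.
rewrite (ptrace_markov (ptrace_last_alexander_R _)
  (braid_rep_add_strand _ _ _) (braid_rep_add_strand _ _ _)).
by rewrite scale1r.
Qed.

(** Closing the extra strand contributes the trace of [mu], which is zero. *)
Lemma alexander_trace_add_strand n (b : braid n) : alexander_trace (add_strand b) = 0.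
Proof.
rewrite /alexander_trace.
have -> : rep (add_strand b) =
    rep (add_strand b) *m local_op (1%:M : 'M[A]_(2 * 2)) (@ord_max n) *m 1%:M.
  by rewrite local_op1 !mulmx1.
rewrite (@ptrace_markov _ _ _ _ _ 0 _ 1%:M _ _ (ptrace_last_alexander_mu _)
  (braid_rep_add_strand _ _ _)).
  by rewrite scale0r scaler0.
by apply/mxeq_sym/mxeq_tens11; rewrite -expnSr.
Qed.

End AlexanderTrace.

(** * Functionals on the Hecke algebra *)

Section Hecke.
Variables (A : comNzRingType) (V : lmodType A) (z : A).

(** A functional on the Hecke algebra with generators [0], ..., [m - 1], given by
its values on words in the generators, without constructing the algebra.
The letters are plain natural numbers, so that the subalgebras for smaller
[m] need no change of alphabet. *)
Record hecke_functional (m : nat) (g : seq nat -> V) : Prop := HeckeFunctional {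
  hecke_far : forall u v i j, (i.+1 < j)%N -> (j < m)%N ->
    g (u ++ i :: j :: v) = g (u ++ j :: i :: v);
  hecke_braid : forall u v i, (i.+1 < m)%N ->
    g (u ++ i :: i.+1 :: i :: v) = g (u ++ i.+1 :: i :: i.+1 :: v);
  hecke_quad : forall u v i, (i < m)%N ->
    g (u ++ i :: i :: v) = g (u ++ v) + z *: g (u ++ i :: v) }.

Notation letters_lt m := (all (fun i : nat => (i < m)%N)).

Lemma hecke_commute_word m g u v w : hecke_functional m.+1 g ->
  letters_lt m.-1 v -> g (u ++ m :: v ++ w) = g (u ++ v ++ m :: w).
Proof.
move=> Hg; elim: v u => [//|i v IHv] u /= /andP[im vm].
rewrite -(hecke_far Hg) //; last by lia.
by rewrite -cat_rcons IHv // cat_rcons.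
Qed.

(** Multiplying by fixed elements on both sides; it is by this that the induction
in [hecke_reduction] reaches the subword between two top generators. *)
Lemma hecke_functional_context m g p q : hecke_functional m.+1 g ->
  hecke_functional m (fun y => g (p ++ y ++ q)).
Proof.
case=> far braid quad; split=> u v.
- by move=> i j ij jm; rewrite -!catA !cat_cons !(catA p) far // ltnW.
- by move=> i im; rewrite -!catA !cat_cons !(catA p) braid // ltnW.
- by move=> i im; rewrite -!catA !cat_cons !(catA p) quad // ltnW.
Qed.

Lemma split_top m (w : seq nat) : letters_lt m.+1 w ->
  letters_lt m w \/ exists u v, [/\ w = u ++ m :: v, letters_lt m u & letters_lt m.+1 v].
Proof.
elim: w => [|i w IHw] /=; first by left.
case/andP; rewrite ltnS leq_eqVlt => /orP[/eqP-> wm|im wm].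
  by right; exists [::], w.
rewrite im /=; case: (IHw wm) => [->|[u [v [-> um vm]]]]; first by left.
by right; exists (i :: u), v; rewrite /= im.
Qed.

(** Induction on the number of occurrences of the top generator [t] in a word.
Let t y t be a part of the word with [y] free of [t]. By induction on [m], [y]
may be assumed to contain the next generator s at most once. If [y] is free of
s it commutes with t, and t t reduces by the quadratic relation. If y = a s b,
then t a s b t = a t s t b = a s t s b. In both cases fewer t remain. *)
Lemma hecke_reduction m g : hecke_functional m.+1 g ->
  (forall u, letters_lt m u -> g u = 0) ->
  (forall u v, letters_lt m u -> letters_lt m v -> g (u ++ m :: v) = 0) ->
  forall w, letters_lt m.+1 w -> g w = 0.
Proof.
elim: m g => [|m IHm] g Hg g0 g1 w.
  have [k] := ubnP (count_mem 0%N w); elim: k w => // k IHk w wk wm.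
  case: (split_top wm) => [/g0//|[u [v [wE um]]]].
  case/split_top => [/(g1 _ _ um)|[y [q [vE ym qm]]]]; first by rewrite -wE.
  have {ym}y0 : y = [::] by case: (y) ym.
  rewrite wE vE y0 cat0s; move: wk wm; rewrite wE vE y0 cat0s.
  rewrite !(count_cat, all_cat) /= => wk /andP[um' _].
  by rewrite (hecke_quad Hg) // !IHk ?scaler0 ?addr0 ?(all_cat, count_cat) /= ?um' ?qm //; lia.
have [k] := ubnP (count_mem m.+1 w); elim: k w => // k IHk w wk wm.
case: (split_top wm) => [/g0//|[u [v [wE um]]]].
case/split_top => [/(g1 _ _ um)|[y [q [vE ym qm]]]]; first by rewrite -wE.
have um' : letters_lt m.+2 u by apply: sub_all um => i; apply: ltnW.
pose g' y := g (rcons u m.+1 ++ y ++ m.+1 :: q).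
suff: g' y = 0 by rewrite /g' cat_rcons -vE -wE.
have {wk wm}uqk : ((count_mem m.+1 u + count_mem m.+1 q).+2 < k.+1)%N.
  by move: wk; rewrite wE vE !(count_cat, all_cat) /= !count_cat /= !eqxx; lia.
have no_top b : letters_lt m b -> letters_lt m.+2 b /\ count_mem m.+1 b = 0%N.
  move=> bm; split; first by apply: sub_all bm => i /= im; lia.
  by apply/count_memPn/negP => /(allP bm); rewrite ltnNge leqnSn.
apply: IHm ym; first exact: hecke_functional_context.
  move=> b bm; have [bm2 bc] := no_top b bm.
  rewrite /g' cat_rcons (hecke_commute_word _ _ Hg) // catA (hecke_quad Hg) //.
  rewrite !IHk ?scaler0 ?addr0 // ?(all_cat, count_cat) /= ?(all_cat, count_cat) ?um' ?qm ?bm2 ?ltnSn //.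
    by rewrite bc eqxx addn0 add1n addnS.
  by rewrite bc addn0; apply: ltnW uqk.
move=> a b am bm; have [am2 ac] := no_top a am; have [bm2 bc] := no_top b bm.
rewrite /g' -!catA cat_cons cat_rcons (hecke_commute_word _ _ Hg) //.
have -> : u ++ a ++ m.+1 :: m :: b ++ m.+1 :: q
    = (u ++ a ++ [:: m.+1; m]) ++ b ++ m.+1 :: q by rewrite -!catA.
rewrite -(hecke_commute_word _ _ Hg) //.
rewrite -!catA /= (catA u) -(hecke_braid Hg) //.
apply: IHk; rewrite !(all_cat, count_cat) /= !(all_cat, count_cat).
  by rewrite ac bc (ltn_eqF (ltnSn m)) eqxx addn0 !add0n addnS.
by rewrite um' am2 bm2 qm !ltnS leqnn leqnSn.
Qed.

Section PositiveReduction.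
Variables (n : nat) (f : braid n -> V).

(** The skein relation replaces an inverse generator by the generator and a
shorter word. *)
Lemma positive_reduction :
  (forall u v i, f (u ++ (i, true) :: v) - f (u ++ (i, false) :: v) = z *: f (u ++ v)) ->
  (forall s : seq 'I_n, f [seq (i, true) | i <- s] = 0) -> forall b, f b = 0.
Proof.
move=> skein f0 b.
suff H s : f ([seq (i, true) | i <- s] ++ b) = 0 by apply: (H [::]).
elim: b s => [|[i e] b IHb] s; first by rewrite cats0.
have fT : f ([seq (i, true) | i <- s] ++ (i, true) :: b) = 0.
  by rewrite -cat_rcons -(map_rcons (fun i => (i, true))) IHb.
case: e => //; apply/eqP; rewrite -oppr_eq0; apply/eqP.
by have := skein [seq (i, true) | i <- s] b i; rewrite fT IHb scaler0 sub0r.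
Qed.

End PositiveReduction.

End Hecke.

(** * Comparison with the Alexander polynomial *)

(** Letters that are out of range are dropped, so that this is a total morphism
of monoids. *)
Definition positive_word n (w : seq nat) : braid n := [seq (i, true) | i <- pmap insub w].

Lemma positive_word_cat n u v : positive_word n (u ++ v) = positive_word n u ++ positive_word n v.
Proof. by rewrite /positive_word pmap_cat map_cat. Qed.

Lemma positive_word_cons n i v (im : (i < n)%N) :
  positive_word n (i :: v) = (Ordinal im, true) :: positive_word n v.
Proof. by rewrite /positive_word /= insubT. Qed.

Lemma positive_word_add_strand n u : all (fun i => (i < n)%N) u ->
  positive_word n.+1 u = add_strand (positive_word n u).
Proof.
elim: u => //= i u IHu /andP[im um].
rewrite (positive_word_cons u im) (positive_word_cons u (leqW im)) /= IHu //.
by congr ((_, _) :: _); apply: val_inj.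
Qed.

Lemma positive_word_val n (s : seq 'I_n) :
  positive_word n (map val s) = [seq (i, true) | i <- s].
Proof. by rewrite /positive_word (map_pK valK). Qed.

Section Alexander.
Variables (Delta : link -> laurent int).
Hypothesis HD : is_alexander Delta.

(** Both crossings of the added strand with the last one are Markov
stabilisations of the same braid, so the skein relation at this crossing has
left-hand side zero. *)
Lemma alexander_add_strand n (b : braid n) : Delta (braid_closure (add_strand b)) = 0.
Proof.
apply: skein_coef_regular; have := alexander_skein HD (add_strand b) [::] ord_max.
by rewrite cats0 !cats1 -!(alexander_isotopic HD (isotopic_stab _ _)) subrr.
Qed.

(** Conjugation brings the new crossing to the end of the word, where it can be
removed by a Markov move. *)
Lemma alexander_stab n (u v : braid n) :
  Delta (braid_closure (add_strand u ++ (ord_max, true) :: add_strand v))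
  = Delta (braid_closure (u ++ v)).
Proof.
rewrite -cat_rcons (alexander_isotopic HD (isotopic_conj _ _)) -rcons_cat.
rewrite -[add_strand v ++ _]map_cat -(alexander_isotopic HD (isotopic_stab _ _)).
exact/alexander_isotopic/isotopic_conj.
Qed.

Variable k : comNzRingType.
Local Notation z := ('h^(-1) - 'h^1 : laurent k).

Definition alexander_defect n (b : braid n) : 'M[laurent k]_2 :=
  (laurent_of_int k (Delta (braid_closure b)))%:M - alexander_trace (fun e => 'h^e) b.

Lemma alexander_defect_skein n (u v : braid n) i :
  alexander_defect (u ++ (i, true) :: v) - alexander_defect (u ++ (i, false) :: v)
  = z *: alexander_defect (u ++ v).
Proof.
rewrite /alexander_defect opprD opprK addrACA.
rewrite scalerBr -(alexander_trace_skein (laurent_mono0 k) (@laurent_monoD k) _ _ i) scale_scalar_mx.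
rewrite mulrBl -!laurent_of_int_mono -laurent_of_intB -mulrBl -(alexander_skein HD _ _ i).
by rewrite laurent_of_intB raddfB opprD opprK.
Qed.

Lemma alexander_defect_inv n (u v : braid n) i :
  alexander_defect (u ++ (i, false) :: (i, true) :: v) = alexander_defect (u ++ v).
Proof.
rewrite /alexander_defect (alexander_trace_inv (laurent_mono0 k) (@laurent_monoD k)).
by rewrite (alexander_isotopic HD (@isotopic_inv _ u v i false)).
Qed.

Lemma alexander_defect_hecke n :
  hecke_functional z n (fun w => alexander_defect (positive_word n w)).
Proof.
split=> u v i.
- move=> j ij jn; have im : (i < n)%N by apply: ltn_trans jn; apply: ltnW.
  rewrite !positive_word_cat !(positive_word_cons _ jn, positive_word_cons _ im).
  rewrite /alexander_defect alexander_trace_far //.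
  by rewrite (alexander_isotopic HD (@isotopic_far _ (positive_word n u) _ _ _ _)).
- move=> i1n; have im : (i < n)%N by apply: ltnW.
  rewrite !positive_word_cat !(positive_word_cons _ i1n, positive_word_cons _ im).
  rewrite /alexander_defect alexander_trace_braid //.
  by rewrite (alexander_isotopic HD (@isotopic_braid _ (positive_word n u) _ _ _ _)).
- move=> im; rewrite !positive_word_cat !(positive_word_cons _ im).
  by rewrite -(alexander_defect_skein _ _ (Ordinal im)) alexander_defect_inv addrC subrK.
Qed.

Lemma alexander_defect0 n (b : braid n) : alexander_defect b = 0.
Proof.
elim: n b => [|n IHn] b.
  case: b => [|[[]//]]; rewrite /alexander_defect (alexander_trace_unknot (laurent_mono0 k)).
  by rewrite (alexander_unknot HD) laurent_of_int1 subrr.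
apply: (positive_reduction (@alexander_defect_skein n.+1)) => s; rewrite -positive_word_val.
apply: (hecke_reduction (alexander_defect_hecke n.+1)).
- move=> u un; rewrite positive_word_add_strand // /alexander_defect.
  by rewrite alexander_add_strand alexander_trace_add_strand laurent_of_int0 subr0 raddf0.
- move=> u v un vn; rewrite positive_word_cat (positive_word_cons _ (ltnSn n)).
  rewrite !positive_word_add_strand // (_ : Ordinal _ = ord_max); last exact: val_inj.
  by rewrite /alexander_defect alexander_stab alexander_trace_stab; apply: IHn.
- by apply/allP => i /mapP[j _ ->]; apply: ltn_ord.
Qed.

End Alexander.

Theorem theorem9p6 (k : comNzRingType) :
  exists (d N : nat) (phi phi' : 'I_N.+1 -> 'M[k]_(d * d)) (mu : 'M[k]_d),
    [/\ (0 < d)%N,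
        laurent_deformation phi phi' &
        forall Delta : link -> laurent int, is_alexander Delta ->
        forall (K : link) (n : nat) (b : braid n),
          isotopic K (braid_closure b) ->
          (laurent_of_int k (Delta K))%:M =
          'h^(- (crossings true b)%:Z + (crossings false b)%:Z + n.+1%:Z - 1)
            *: ptrace (braid_rep (laurent_R phi) (laurent_Rinv phi') b
                 *m id_tens n (map_mx (in_alg (laurent k)) mu))].
Proof.
exists 2, 2, (@alexander_phi k), (@alexander_phi' k), (alexander_mu k).
have RE : laurent_R (@alexander_phi k) = alexander_R 'h^1 by exact: deform_alexander.
have R'E : laurent_Rinv (@alexander_phi' k) = alexander_R' 'h^(-1) by exact: deform_alexander'.
have hhV : 'h^1 * 'h^(-1) = 1 :> laurent k by rewrite -laurent_monoD.
split=> //.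
- have [RK R'K] := alexander_R_inv hhV.
  split=> [n _|n _||||].
  + by rewrite (deform_truncate _ (qpolyX_pow0 k n)) deform_alexander; apply: alexander_R_YBO.
  + by rewrite (deform_truncate _ (qpolyX_pow0 k n)) deform_alexander'; apply: alexander_R'_YBO.
  + by rewrite RE; apply: alexander_R_YBO.
  + by rewrite R'E; apply: alexander_R'_YBO.
  + rewrite RE R'E; exact: RK.
  + rewrite RE R'E; exact: R'K.
- move=> Delta HD K n b Kb; rewrite RE R'E map_alexander_mu (alexander_isotopic HD Kb).
  by apply/eqP; rewrite -subr_eq0; apply/eqP/alexander_defect0.
Qed.
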